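(* Let $N\ge 1$, $k\ge 1$ be integers and $V=\mathbb{R}^k$. Let $T\subset V^N$ be a bounded set and let $h_1,\ldots,h_N$ be functions $V\to\mathbb{R}$ such that each $h_i$ is $(M_i,\ell_\infty)$-Lipschitz and satisfies the vanishing condition that $h_i(\boldsymbol{t})=0$ whenever some coordinate $t_j$ of $\boldsymbol{t}=(t_1,\ldots,t_k)$ equals $0$. Let $\varepsilon_i$ ($i\le N$) and $\varepsilon_{ij}$ ($i\le N$, $j\le k$) be mutually independent Rademacher variables. Then, for any convex and nondecreasing function $\Phi:[0,\infty)\to\mathbb{R}$, $$ \mathsf{E}\,\Phi\Big(\tfrac12\sup_{\boldsymbol{t}\in T}\Big|\sum_{i\le N}\varepsilon_i h_i(\boldsymbol{t}_i)\Big|\Big) \le \mathsf{E}\,\Phi\Big(\Big(\sup_{\boldsymbol{t}\in T}\sum_{i\le N,\,j\le k} M_i\varepsilon_{ij}t_{ij}\Big)^+\Big) \le \mathsf{E}\,\Phi\Big(\sup_{\boldsymbol{t}\in T}\Big|\sum_{i\le N,\,j\le k} M_i\varepsilon_{ij}t_{ij}\Big|\Big). $$ Furthermore, for any convex and nondecreasing $G:\mathbb{R}\to\mathbb{R}$, $$ \mathsf{E}\,G\Big(\sup_{\boldsymbol{t}\in T}\sum_{i\le N}\varepsilon_i h_i(\boldsymbol{t}_i)\Big) \le \mathsf{E}\,G\Big(\sup_{\boldsymbol{t}\in T}\sum_{i\le N,\,j\le k} M_i\varepsilon_{ij}t_{ij}\Big). $$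
   Context: Elements of $V^N$ are written $\boldsymbol{t}=(\boldsymbol{t}_1,\ldots,\boldsymbol{t}_N)$ with $\boldsymbol{t}_i=(t_{i1},\ldots,t_{ik})\in V=\mathbb{R}^k$. A Rademacher variable $\varepsilon$ satisfies $\Pr\{\varepsilon=1\}=\Pr\{\varepsilon=-1\}=1/2$. A function $h:\mathbb{R}^k\to\mathbb{R}$ is called $(M,\ell_\infty)$-Lipschitz if $|h(\boldsymbol{t})-h(\boldsymbol{s})|\le M\|\boldsymbol{t}-\boldsymbol{s}\|_\infty$ for all $\boldsymbol{s},\boldsymbol{t}\in\mathbb{R}^k$, where $\|\boldsymbol{s}\|_\infty=\max_{j\le k}|s_j|$. $x^+=\max(x,0)$. *)

(* Defs.v *)
From HB Require Import structures.
From mathcomp Require Export all_boot all_order all_algebra.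
From mathcomp Require Export all_classical all_reals all_analysis.

Set Implicit Arguments.
Unset Strict Implicit.
Unset Printing Implicit Defensive.

Export Order.TTheory GRing.Theory Num.Theory.
Export numFieldNormedType.Exports.

Local Open Scope classical_set_scope.
Local Open Scope ring_scope.

Definition rademacher (d : measure_display) (Omega : measurableType d)
    (R : realType) (P : probability Omega R) (X : {RV P >-> R}) : Prop :=
  P (X @^-1` [set 1]) = (2^-1)%:E /\ P (X @^-1` [set -1]) = (2^-1)%:E.

Definition mutually_independent (d : measure_display)
    (Omega : measurableType d) (R : realType) (P : probability Omega R)
    (I : finType) (X : I -> {RV P >-> R}) : Prop :=
  forall (J : {set I}) (B : I -> set R),
    (forall i, i \in J -> measurable (B i)) ->
    P (\bigcap_(i in [set` J]) (X i @^-1` B i)) =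
      (\prod_(i in J) P (X i @^-1` B i))%E.

(* The variables X_i and Y_ij gathered into a single family. *)
Definition join_family (T : Type) (N k : nat)
    (X : 'I_N -> T) (Y : 'I_N -> 'I_k -> T) (s : 'I_N + 'I_N * 'I_k) : T :=
  match s with
  | inl i => X i
  | inr ij => Y ij.1 ij.2
  end.

(* Main.v *)
Require Import Defs.
From mathcomp Require Import lra measurable_realfun.

Set Implicit Arguments.
Unset Strict Implicit.
Unset Printing Implicit Defensive.

Local Open Scope classical_set_scope.
Local Open Scope ring_scope.

(* Taking the expectation over all other signs, it suffices to replace one
   function h_i at a time: with a(t) the remaining terms,
     (G(sup (a + h_i)) + G(sup (a - h_i))) / 2
       <= E G(sup (a + M_i sum_j eps_ij t_ij)).
   Given t and s that nearly attain the two suprema on the left, choose j with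
   |h_i(t) - h_i(s)| <= M_i |t_j - s_j|.  Jensen's inequality removes the signs
   eps_il, l <> j, and since the vanishing condition gives
   |h_i(t)| <= M_i |t_j|, the pair (a(t) + h_i(t), a(s) - h_i(s)) is weakly
   majorized by the pair of maxima of a + M_i t_j and a - M_i t_j over {t, s}.
   The statement for Phi follows with G(x) = Phi(x^+), from
   |x| = x^+ + x^- and the symmetry of the signs. *)

(** * Convex nondecreasing functions and suprema *)

Lemma convex_functionP (R : realType) (D : set R) (f : R -> R) (x y l : R) :
  @convex_function R R^o D f -> D x -> D y -> 0 <= l -> l <= 1 ->
  f (l * x + (1 - l) * y) <= l * f x + (1 - l) * f y.
Proof.
move=> cf Dx Dy l0 l1.
by have := cf (Itv01 l0 l1) x y (mem_set Dx) (mem_set Dy).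
Qed.

Section convex_nondecreasing.
Variables (R : realType) (G : R -> R).
Hypotheses (G_convex : @convex_function R R^o setT G)
  (G_nd : nondecreasing_fun G).

(** After sorting each pair, either [d <= d'] and monotonicity suffices, or [d' < d <= c <= c'].
    Then [c] is a convex combination of [c'] and [d'], and [d] is at most the mirrored one because
    [c + d <= c' + d']. *)
Lemma weak_majorization (c d c' d' : R) :
  Num.max c d <= Num.max c' d' -> c + d <= c' + d' -> G c + G d <= G c' + G d'.
Proof.
wlog dc : c d / d <= c => [hw|].
  case/orP: (le_total d c) => [dc|cd]; first exact: hw.
  by rewrite maxC (addrC c) (addrC (G c)); exact: hw.
wlog dc' : c' d' / d' <= c' => [hw|].
  case/orP: (le_total d' c') => [dc'|cd']; first exact: hw.
  by rewrite (maxC c') (addrC c') (addrC (G c')); exact: hw.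
rewrite (max_l dc) (max_l dc') => cc' cd.
have [dd'|d'd] := leP d d'; first by apply: lerD; exact: G_nd.
have c'd' : 0 < c' - d' by lra.
pose l := (c - d') / (c' - d').
have l0 : 0 <= l by apply: divr_ge0; lra.
have l1 : l <= 1 by rewrite ler_pdivrMr// mul1r; lra.
have lE : l * (c' - d') = c - d' by rewrite divfK// gt_eqF.
have h1 := convex_functionP G_convex (x := c') (y := d') I I l0 l1.
have h2 := convex_functionP G_convex (x := d') (y := c') I I l0 l1.
have Gc : G c <= l * G c' + (1 - l) * G d'.
  by apply: le_trans h1; apply: G_nd; lra.
have Gd : G d <= l * G d' + (1 - l) * G c'.
  by apply: le_trans h2; apply: G_nd; lra.
lra.
Qed.

Lemma convex_midpoint (x y z : R) : z + z <= x + y -> G z + G z <= G x + G y.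
Proof.
by move=> zxy; apply: weak_majorization; rewrite // maxxx le_max; lra.
Qed.

Variables (U : Type) (T : set U).
Hypothesis T0 : T !=set0.
Implicit Types f g : U -> R.

Definition bounded_on (f : U -> R) := exists B, forall u, T u -> `|f u| <= B.

Local Notation S f := (sup [set f u | u in T]).

Lemma bounded_on_has_sup f : bounded_on f -> has_sup [set f u | u in T].
Proof.
move=> [B fB]; split; first by case: T0 => u Tu; exists (f u), u.
by exists B => _ [u Tu <-]; exact: le_trans (ler_norm _) (fB u Tu).
Qed.

Lemma le_sup_image f u : bounded_on f -> T u -> f u <= S f.
Proof.
by move=> /bounded_on_has_sup [_ fB] Tu; apply: ub_le_sup => //; exists u.
Qed.

Lemma sup_image_le f c : (forall u, T u -> f u <= c) -> S f <= c.
Proof.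
move=> fc; apply: ge_sup; first by case: T0 => u Tu; exists (f u), u.
by move=> _ [u Tu <-]; exact: fc.
Qed.

Lemma eq_sup_image f g : (forall u, T u -> f u = g u) -> S f = S g.
Proof.
by move=> fg; congr sup; apply/seteqP; split => _ [u Tu <-]; exists u;
  rewrite ?fg.
Qed.

(* Left continuity of [G] at the supremum, from the slope inequality
   [G x - G (x - e) <= e (G (x + 1) - G x)]. *)
Lemma convex_sup_le f C : bounded_on f ->
  (forall u, T u -> G (f u) <= C) -> G (S f) <= C.
Proof.
move=> fB GfC; set x := S f.
apply/ler_addgt0Pr => n n0.
pose D := G (x + 1) - G x.
have D0 : 0 <= D by rewrite subr_ge0; apply: G_nd; lra.
(* The [+ 1] keeps the denominator positive when [D = 0]; this [e] gives [e * D <= n]. *)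
pose e := Num.min 1 (n / (D + 1)).
have e0 : 0 < e by rewrite lt_min ltr01/= divr_gt0//; lra.
have e1 : e <= 1 by rewrite ge_min lexx.
have eD : e * D <= n.
  have : e * (D + 1) <= n.
    by rewrite -ler_pdivlMr; [rewrite ge_min lexx orbT|lra].
  by apply: le_trans; rewrite ler_pM2l//; lra.
have [_ [u Tu <-] /ltW xu] := sup_adherent e0 (bounded_on_has_sup fB).
have GxC : G (x - e) <= C by apply: le_trans (GfC u Tu); exact: G_nd.
have p0 : 0 < 1 + e by lra.
(* The weight that makes [x] a convex combination of [x - e] and [x + 1]. *)
pose l := (1 + e)^-1.
have l0 : 0 <= l by rewrite invr_ge0; lra.
have lE : l * (1 + e) = 1 by rewrite mulVf// gt_eqF.
have l1 : l <= 1 by nra.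
have := convex_functionP G_convex (x := x - e) (y := x + 1) I I l0 l1.
have -> : l * (x - e) + (1 - l) * (x + 1) = x by nra.
have -> : 1 - l = l * e by lra.
move=> h.
have : (1 + e) * G x <= (1 + e) * (l * G (x - e) + l * e * G (x + 1)).
  by rewrite ler_pM2l.
rewrite mulrDr !mulrA (mulrC _ l) lE !mul1r.
rewrite /D in eD; lra.
Qed.

(** The suprema are approached at unrelated points, so they are treated in turn, the other value of
    [G] being absorbed into the constant. *)
Lemma convex_sup_pair_le f g C : bounded_on f -> bounded_on g ->
  (forall u v, T u -> T v -> G (f u) + G (g v) <= C) -> G (S f) + G (S g) <= C.
Proof.
move=> fB gB fgC; rewrite -lerBrDr; apply: convex_sup_le => // u Tu.
rewrite lerBrDr addrC -lerBrDr; apply: convex_sup_le => // v Tv.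
by rewrite lerBrDr addrC; exact: fgC.
Qed.

End convex_nondecreasing.

(** * Bounded functions on a set *)

Section bounded_on.
Variables (R : realType) (U : Type) (T : set U).

Lemma bounded_onD (f g : U -> R) :
  bounded_on T f -> bounded_on T g -> bounded_on T (fun u => f u + g u).
Proof.
move=> [A fA] [B gB]; exists (A + B) => u Tu.
by apply: le_trans (ler_normD _ _) _; apply: lerD; [exact: fA|exact: gB].
Qed.

Lemma bounded_onM c (f : U -> R) :
  bounded_on T f -> bounded_on T (fun u => c * f u).
Proof.
move=> [A fA]; exists (`|c| * A) => u Tu.
by rewrite normrM ler_wpM2l//; exact: fA.
Qed.

Lemma bounded_onN (f : U -> R) :
  bounded_on T f -> bounded_on T (fun u => - f u).
Proof. by move=> [A fA]; exists A => u Tu; rewrite normrN; exact: fA. Qed.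

Lemma bounded_on_norm (f : U -> R) :
  bounded_on T f -> bounded_on T (fun u => `|f u|).
Proof. by move=> [A fA]; exists A => u Tu; rewrite normr_id; exact: fA. Qed.

Lemma bounded_on_sum (I : Type) (r : seq I) (P : pred I) (f : I -> U -> R) :
  (forall i, bounded_on T (f i)) ->
  bounded_on T (fun u => \sum_(i <- r | P i) f i u).
Proof.
move=> fB; elim: r => [|i r IH].
  by exists 0 => u Tu; rewrite big_nil normr0.
case Pi : (P i); last first.
  by case: IH => A IH; exists A => u Tu; rewrite big_cons Pi; exact: IH.
have [A fA] := bounded_onD (fB i) IH.
by exists A => u Tu; rewrite big_cons Pi; exact: fA.
Qed.

End bounded_on.

(** * Reversal of signs *)

Section flip.
Variables (I : finType).

Definition flip (A : pred I) (s : {ffun I -> bool}) : {ffun I -> bool} :=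
  [ffun i => s i (+) A i].

Lemma flipK A : involutive (flip A).
Proof. by move=> s; apply/ffunP => i; rewrite !ffunE -addbA addbb addbF. Qed.

(** The symmetry of Rademacher signs in finite form; it lets a sum be averaged with its flipped
    copy. *)
Lemma sum_flip (V : nmodType) (A : pred I) (F : {ffun I -> bool} -> V) :
  \sum_s F s = \sum_s F (flip A s).
Proof. by rewrite (reindex_inj (can_inj (flipK A))). Qed.

End flip.

(** * Contraction for sums over sign vectors *)

Section contraction.
Variables (R : realType) (G : R -> R).
Hypotheses (G_convex : @convex_function R R^o setT G)
  (G_nd : nondecreasing_fun G).
Variables (U : Type) (T : set U).
Hypothesis T0 : T !=set0.
Implicit Types f g : U -> R.

Local Notation S f := (sup [set f u | u in T]).
Local Notation bounded f := (bounded_on T f).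

Let bounded_sign (b : bool) f : bounded f -> bounded (fun u => (-1) ^+ b * f u).
Proof. exact: bounded_onM. Qed.

(* Averaging a sign vector with the one that differs from it off [j] leaves only
   the [j]-th term, so convexity discards all the other signs. *)
Let keep_one_sign k (a : U -> R) (p : 'I_k -> U -> R) j :
  bounded a -> (forall l, bounded (p l)) ->
  \sum_(b : {ffun 'I_k -> bool})
    (G (S (fun u => a u + p j u)) + G (S (fun u => a u - p j u))) <=
  2 * \sum_(b : {ffun 'I_k -> bool})
    G (S (fun u => a u + \sum_l (-1) ^+ b l * p l u)).
Proof.
move=> aB pB.
pose F (b : {ffun 'I_k -> bool}) :=
  G (S (fun u => a u + \sum_l (-1) ^+ b l * p l u)).
pose Q (c : bool) := G (S (fun u => a u + (-1) ^+ c * p j u)).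
(* Reversing [b j] alone pairs the term with [+ p j] and the term with [- p j]. *)
have -> : \sum_(b : {ffun 'I_k -> bool})
    (G (S (fun u => a u + p j u)) + G (S (fun u => a u - p j u))) =
    2 * \sum_(b : {ffun 'I_k -> bool}) Q (b j).
  rewrite mulr_natl mulr2n [X in _ = _ + X](sum_flip (pred1 j)) -big_split/=.
  apply: eq_bigr => b _; rewrite ffunE/= eqxx addbT /Q.
  case: (b j); rewrite /= ?expr1 ?expr0; [rewrite addrC|]; congr (G _ + G _);
    by apply: eq_sup_image => u _; rewrite ?mulN1r ?mul1r.
suff : 2 * \sum_(b : {ffun 'I_k -> bool}) Q (b j) <= 2 * \sum_b F b.
  by rewrite ler_pM2l.
rewrite !mulr_natl !mulr2n [X in _ <= _ + X](sum_flip (predC1 j)) -!big_split/=.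
apply: ler_sum => b _; apply: convex_midpoint => //.
have FB c : bounded (fun u => a u + \sum_l (-1) ^+ (c l : bool) * p l u).
  apply: bounded_onD => //; apply: bounded_on_sum => l; exact: bounded_sign.
rewrite -mulr2n -mulr_natl -ler_pdivlMl// mulrC.
apply: sup_image_le => // u Tu; rewrite ler_pdivlMr//.
have := lerD (le_sup_image T0 (FB b) Tu) (le_sup_image T0 (FB (flip (predC1 j) b)) Tu).
apply: le_trans.
have -> : \sum_l (-1) ^+ flip (predC1 j) b l * p l u =
    (-1) ^+ b j * p j u - \sum_(l | l != j) (-1) ^+ b l * p l u.
  rewrite (bigD1 j)//= ffunE/= eqxx addbF -sumrN; congr (_ + _).
  by apply: eq_bigr => l lj; rewrite ffunE/= lj addbT signrN mulNr.
rewrite (bigD1 j)//=; lra.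
Qed.

(** The pointwise bound by [p] encodes the vanishing condition, the bound on differences the
    Lipschitz condition. The left summand is constant in [b], which avoids normalising by the number
    of sign vectors. *)
Lemma block_contraction k (a h : U -> R) (p : 'I_k -> U -> R) :
  bounded a -> bounded h -> (forall j, bounded (p j)) ->
  (forall u j, T u -> `|h u| <= `|p j u|) ->
  (forall u v, T u -> T v -> exists j, `|h u - h v| <= `|p j u - p j v|) ->
  \sum_(b : {ffun 'I_k -> bool})
    (G (S (fun u => a u + h u)) + G (S (fun u => a u - h u))) <=
  2 * \sum_(b : {ffun 'I_k -> bool})
    G (S (fun u => a u + \sum_j (-1) ^+ b j * p j u)).
Proof.
move=> aB hB pB hp hlip.
rewrite sumr_const -[X in X <= _]mulr_natl.
have n0 : 0 < #|{: {ffun 'I_k -> bool}}|%:R :> R.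
  by rewrite ltr0n; apply/card_gt0P; exists [ffun => false].
rewrite -ler_pdivlMl//.
apply: convex_sup_pair_le => //.
- exact: bounded_onD.
- by apply: bounded_onD => //; exact: bounded_onN.
move=> u v Tu Tv; rewrite ler_pdivlMl// [X in X <= _]mulr_natl -sumr_const.
have [j hj] := hlip u v Tu Tv.
apply: le_trans (keep_one_sign j aB pB); apply: ler_sum => b _.
have pjB : bounded (fun u => a u + p j u) by exact: bounded_onD.
have mjB : bounded (fun u => a u - p j u).
  by apply: bounded_onD => //; exact: bounded_onN.
pose x := S (fun u => a u + p j u); pose y := S (fun u => a u - p j u).
have h1 : a u + p j u <= x by exact: (le_sup_image T0 pjB Tu).
have h2 : a v + p j v <= x by exact: (le_sup_image T0 pjB Tv).
have h3 : a u - p j u <= y by exact: (le_sup_image T0 mjB Tu).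
have h4 : a v - p j v <= y by exact: (le_sup_image T0 mjB Tv).
rewrite -/x -/y.
have := hp u j Tu; have := hp v j Tv => hv hu.
apply: weak_majorization => //.
(* Each left argument is at most [a + |p j|] at its own point, hence at most [x] or [y] according to
   the sign of [p j] there. *)
- rewrite ge_max !le_max; move: hu hv h1 h2 h3 h4.
  have := ler_norm (h u); have := ler_norm (- h v); rewrite normrN.
  case: (ger0P (p j u)) => _; case: (ger0P (p j v)) => _ *;
    apply/andP; split; apply/orP; first [left; lra|right; lra].
(* The sign of [p j u - p j v] decides which of [u], [v] is tested in [x] and which in [y]. *)
- move: hj h1 h2 h3 h4; have := ler_norm (h u - h v).
  by case: (ger0P (p j u - p j v)) => _ *; lra.
Qed.

Variables (N k : nat) (h : 'I_N -> U -> R) (p : 'I_N -> 'I_k -> U -> R).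
Hypotheses (hB : forall i, bounded (h i)) (pB : forall i j, bounded (p i j)).
Hypothesis hp : forall i u j, T u -> `|h i u| <= `|p i j u|.
Hypothesis hlip : forall i u v, T u -> T v ->
  exists j, `|h i u - h i v| <= `|p i j u - p i j v|.

Local Notation signs := {ffun 'I_N + 'I_N * 'I_k -> bool}.

Let old (s : signs) (i : 'I_N) u : R := (-1) ^+ s (inl i) * h i u.
Let new (s : signs) (i : 'I_N) u : R := \sum_j (-1) ^+ s (inr (i, j)) * p i j u.

(** Interpolates between the two sides: [old] throughout for [m = 0], [new] throughout for
    [m = N]. *)
Let hybrid m (s : signs) u : R :=
  \sum_(i < N) if (i < m)%N then new s i u else old s i u.

Let oldB s i : bounded (old s i).
Proof. exact: bounded_sign. Qed.

Let newB s i : bounded (new s i).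
Proof. by apply: bounded_on_sum => j; exact: bounded_sign. Qed.

Let hybrid_step m : (m < N)%N ->
  \sum_s G (S (hybrid m s)) <= \sum_s G (S (hybrid m.+1 s)).
Proof.
move=> mN; pose i0 := Ordinal mN.
pose a s u := \sum_(i < N | i != i0) if (i < m)%N then new s i u else old s i u.
have aB s : bounded (a s).
  by apply: bounded_on_sum => i; case: (i < m)%N; [exact: newB|exact: oldB].
have hybrid_m s u : hybrid m s u = a s u + old s i0 u.
  by rewrite /hybrid (bigD1 i0)//= ltnn addrC.
have hybrid_mS s u : hybrid m.+1 s u = a s u + new s i0 u.
  rewrite /hybrid (bigD1 i0)//= ltnSn addrC; congr (_ + _).
  by apply: eq_bigr => i ii0; rewrite ltnS leq_eqVlt (negbTE (ii0 : i != m :> nat)).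
(* Both flips leave [a] unchanged: [A0] reverses the sign of [h i0], and [A b] those of the [p i0 j]
   with [b j] true. *)
pose A0 : pred ('I_N + 'I_N * 'I_k) := pred1 (inl i0).
pose A (b : {ffun 'I_k -> bool}) : pred ('I_N + 'I_N * 'I_k) :=
  fun x => if x is inr ij then (ij.1 == i0) && b ij.2 else false.
have aE B s u : (forall i, i != i0 -> B (inl i) = false) ->
    (forall i j, i != i0 -> B (inr (i, j)) = false) -> a (flip B s) u = a s u.
  move=> Bl Br; apply: eq_bigr => i ii0; rewrite /old ffunE Bl// addbF.
  case: ifP => // _; apply: eq_bigr => j _; by rewrite ffunE Br// addbF.
have lhsE : \sum_(b : {ffun 'I_k -> bool}) \sum_s
     (G (S (fun u => a s u + old s i0 u)) + G (S (fun u => a s u - old s i0 u))) =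
   \sum_(b : {ffun 'I_k -> bool}) 2 * \sum_s G (S (hybrid m s)).
  apply: eq_bigr => b _; rewrite mulr_natl mulr2n [X in _ = _ + X](sum_flip A0) -big_split/=.
  apply: eq_bigr => s _; congr (G _ + G _); apply: eq_sup_image => u _;
    rewrite hybrid_m //.
  rewrite aE; last 2 first.
  - by move=> i; exact: negbTE.
  - by [].
  by rewrite /old ffunE /A0/= eqxx addbT signrN mulNr.
(* The auxiliary signs [b] multiply signs already present in [s], so reindexing by [A b] absorbs
   them. *)
have rhsE : \sum_s 2 * \sum_(b : {ffun 'I_k -> bool}) G (S (fun u => a s u +
      \sum_j (-1) ^+ b j * ((-1) ^+ s (inr (i0, j)) * p i0 j u))) =
    \sum_(b : {ffun 'I_k -> bool}) 2 * \sum_s G (S (hybrid m.+1 s)).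
  rewrite -!mulr_sumr exchange_big/=; congr (_ * _); apply: eq_bigr => b _.
  rewrite [RHS](sum_flip (A b)); apply: eq_bigr => s _; congr G.
  apply: eq_sup_image => u _; rewrite hybrid_mS aE//; last first.
    by move=> i j /negbTE/= ->.
  congr (_ + _); apply: eq_bigr => j _.
  by rewrite ffunE/= eqxx/= signr_addb mulrA (mulrC (_ ^+ b j)).
have : \sum_(b : {ffun 'I_k -> bool}) 2 * \sum_s G (S (hybrid m s)) <=
    \sum_(b : {ffun 'I_k -> bool}) 2 * \sum_s G (S (hybrid m.+1 s)).
  rewrite -lhsE -rhsE exchange_big/=; apply: ler_sum => s _.
  apply: block_contraction => //.
  - by move=> j; exact: bounded_sign.
  - by move=> u j Tu; rewrite /old !normrMsign; exact: hp.
  - move=> u v Tu Tv; have [j hj] := hlip i0 Tu Tv; exists j.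
    by rewrite /old -!mulrBr !normrMsign.
(* Neither side depends on [b], so the positive number of vectors [b] cancels. *)
rewrite !sumr_const lerMn2r ler_pM2l// => /orP[|//].
by rewrite -leqn0 leqNgt; apply: contraNT => _; apply/card_gt0P; exists [ffun => false].
Qed.

Lemma rademacher_contraction :
  \sum_(s : signs) G (S (fun u => \sum_i (-1) ^+ s (inl i) * h i u)) <=
  \sum_(s : signs)
    G (S (fun u => \sum_i \sum_j (-1) ^+ s (inr (i, j)) * p i j u)).
Proof.
have step m : (m <= N)%N -> \sum_s G (S (hybrid 0 s)) <= \sum_s G (S (hybrid m s)).
  elim: m => [//|m IH mN]; apply: le_trans (hybrid_step mN).
  exact: IH (ltnW mN).
have := step N (leqnn N); congr (_ <= _); apply: eq_bigr => s _; congr (G _).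
apply: eq_sup_image => u _; rewrite /hybrid; apply: eq_bigr => i _.
by rewrite ltn_ord.
Qed.

End contraction.

(** * Integrals of functions that agree off a null set *)

Section integral_off_null.
Local Open Scope ereal_scope.
Context d (T : measurableType d) (R : realType) (mu : {measure set T -> \bar R}).
Variable N : set T.
Hypotheses (mN : measurable N) (N0 : mu N = 0).

Import HBNNSimple.

(* No measurability of the integrands is assumed: this compares suprema over
   simple functions. *)
Let ge0_le_integral_off_null (f g : T -> \bar R) :
  (forall x, 0 <= f x) -> (forall x, 0 <= g x) ->
  (forall x, ~ N x -> f x = g x) -> \int[mu]_x f x <= \int[mu]_x g x.
Proof.
move=> f0 g0 fg; rewrite !ge0_integralTE//; apply: ge_ereal_sup => _ [h /= hf <-].
have mCN : measurable (~` N) by exact: measurableC.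
(* Restricting [h] to the complement of [N] keeps its integral and puts it below [g]. *)
apply: ereal_sup_ubound; exists (proj_nnsfun h mCN) => /= [x|].
  rewrite mindicE; have [|] := boolP (x \in ~` N).
    by rewrite inE mulr1 => /fg <-.
  by rewrite mulr0.
have sE (k : {nnsfun T >-> R}) : sintegral mu k = \int[mu]_x (k x)%:E.
  by rewrite integral_nnsfun// patch_setT.
rewrite !sE.
apply: ge0_ae_eq_integral => //.
- exact/measurable_EFinP.
- exact/measurable_EFinP.
- by move=> x _; rewrite lee_fin.
- by move=> x _; rewrite lee_fin.
exists N; split => // x /= xN; apply: contrapT => Nx; apply: xN => _ /=.
by rewrite mindicE mem_set// mulr1.
Qed.

Lemma integral_off_null (f g : T -> \bar R) :
  (forall x, ~ N x -> f x = g x) -> \int[mu]_x f x = \int[mu]_x g x.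
Proof.
move=> fg; rewrite integralE [RHS]integralE; congr (_ - _); apply/eqP; rewrite eq_le;
  by apply/andP; split; apply: ge0_le_integral_off_null => // x /fg;
    rewrite ?funeposE ?funenegE => ->.
Qed.

End integral_off_null.

(** * Expectations as averages over sign vectors *)

Section rademacher_expectation.
Context d (Omega : measurableType d) (R : realType) (P : probability Omega R).
Variables (I : finType) (X : I -> {RV P >-> R}).
Hypotheses (X_rademacher : forall i, rademacher (X i))
  (X_indep : mutually_independent X).

Let A (s : {ffun I -> bool}) := [set w | forall i, X i w = (-1) ^+ s i].

Let AE s : A s = \bigcap_(i in [set` [set: I]%SET]) (X i @^-1` [set (-1) ^+ s i]).
Proof.
apply/seteqP; split => w /= Aw i; first by move=> _; exact: Aw.
by apply: Aw; rewrite /= inE.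
Qed.

Let mA s : measurable (A s).
Proof.
rewrite AE; apply: fin_bigcap_measurable; first exact: finite_finset.
by move=> i _; rewrite -[X in measurable X]setTI; exact: measurable_funP.
Qed.

Let PA s : P (A s) = ((2^-1) ^+ #|I|)%:E.
Proof.
rewrite AE X_indep; last by move=> i _; exact: measurable_set1.
rewrite (eq_bigr (fun=> (2^-1)%:E)); last first.
  move=> i _; have [X1 XN1] := X_rademacher i.
  by case: (s i); rewrite ?expr1 ?expr0.
by rewrite prodEFin prodr_const cardsT.
Qed.

Let A_inj s s' w : A s w -> A s' w -> s = s'.
Proof.
move=> As As'; apply/ffunP => i; apply: (@signr_inj R).
by rewrite -(As i) -(As' i).
Qed.

Let integral_step (F : {ffun I -> bool} -> R) :
  (\int[P]_w (\sum_s F s * \1_(A s) w)%:E =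
    ((2^-1) ^+ #|I| * \sum_s F s)%:E)%E.
Proof.
have iA s : P.-integrable setT (fun w => (\1_(A s) w)%:E).
  exact: integrable_indic.
under eq_integral do rewrite -sumEFin.
rewrite integral_sum//; last first.
  by move=> s; under eq_fun do rewrite EFinM; exact: integrableZl.
rewrite mulr_sumr -sumEFin; apply: eq_bigr => s _.
under eq_integral do rewrite EFinM.
rewrite integralZl// integral_indic// setIT -[LHS]/((F s)%:E * P (A s))%E PA.
by rewrite -EFinM mulrC.
Qed.

Let step_on (F : {ffun I -> bool} -> R) s w :
  A s w -> \sum_s' F s' * \1_(A s') w = F s.
Proof.
move=> As; rewrite (bigD1 s)//= indicE mem_set// mulr1 big1 ?addr0// => s' s's.
rewrite indicE memNset ?mulr0// => As'.
by move/eqP: s's; apply; exact: A_inj As' As.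
Qed.

Let D := \bigcup_(s in [set: {ffun I -> bool}]) A s.

Let mD : measurable D.
Proof. by apply: fin_bigcup_measurable => // s _; exact: mA. Qed.

(** The [2 ^ #|I|] disjoint events [A s] have probability [2^-1 ^+ #|I|] each; integrating the step
    function with all values 1 adds these up to 1. *)
Let PDC : P (~` D) = 0%E.
Proof.
rewrite probability_setC// (_ : P D = 1%E) ?subee//.
have := integral_step (fun=> 1).
rewrite (eq_integral (fun w => (\1_D w)%:E)) => [|w _]; last first.
  have [[s _ As]|nD] := pselect (D w).
    by rewrite (step_on _ As) indicE mem_set//; exists s.
  rewrite indicE memNset// big1// => s _; rewrite indicE memNset ?mulr0// => As.
  by apply: nD; exists s.
rewrite integral_indic// setIT => ->; rewrite sumr_const card_ffun card_bool.
by rewrite natrX -exprMn mulVf// expr1n.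
Qed.

(** [F] is arbitrary, so the integrand need not be measurable; on [D], which has full probability,
    it agrees with a function constant on each [A s]. *)
Lemma rademacher_expectation (F : (I -> R) -> R) :
  ('E_P[fun w => F (X ^~ w)] =
   ((2^-1) ^+ #|I| * \sum_(s : {ffun I -> bool}) F (fun i => (-1) ^+ s i))%:E)%E.
Proof.
rewrite unlock -integral_step.
apply: (integral_off_null (measurableC mD) PDC) => w /contrapT[s _ As].
by rewrite (step_on _ As); congr (F _)%:E; apply/funext => i; exact: As.
Qed.

End rademacher_expectation.

(** * Composition with the positive part *)

Section positive_part.
Variables (R : realType) (Phi : R -> R).
Hypotheses (Phi_convex : @convex_function R R^o `[0, +oo[ Phi)
  (Phi_nd : {in `[0, +oo[ &, nondecreasing_fun Phi}).

Lemma nondecreasing_pos x y : 0 <= x -> x <= y -> Phi x <= Phi y.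
Proof.
by move=> x0 xy; apply: Phi_nd => //; rewrite in_itv/= andbT// (le_trans x0).
Qed.

(** The positive part is convex with values in [[0, +oo[], where [Phi] is convex and
    nondecreasing. *)
Lemma convex_function_pos_part :
  @convex_function R R^o setT (fun x => Phi (Num.max x 0)).
Proof.
move=> t x y _ _; set l : R := t%:inum.
have l0 : 0 <= l by rewrite /l.
have l1 : l <= 1 by rewrite /l.
have pos z : (`[0, +oo[%classic : set R) (Num.max z 0)
  by rewrite /= in_itv/= andbT le_max lexx orbT.
have := convex_functionP Phi_convex (pos x) (pos y) l0 l1; apply: le_trans.
apply: nondecreasing_pos; first by rewrite le_max lexx orbT.
have mx z : z <= Num.max z 0 /\ 0 <= Num.max z 0 :> R.
  by rewrite !le_max !lexx orbT.
have [x1 x0] := mx x; have [y1 y0] := mx y.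
rewrite ge_max -[conv t x y]/(l * x + (1 - l) * y).
by apply/andP; split; [apply: lerD; apply: ler_wpM2l; lra|
  apply: addr_ge0; apply: mulr_ge0; lra].
Qed.

Lemma nondecreasing_pos_part : nondecreasing_fun (fun x => Phi (Num.max x 0)).
Proof.
move=> x y xy; apply: nondecreasing_pos; first by rewrite le_max lexx orbT.
by rewrite ge_max !le_max xy lexx orbT.
Qed.

End positive_part.

(** * Lipschitz functions for the max norm *)

Section rows.
Variable R : realType.

Lemma le_coord_norm m n (x : 'M[R]_(m, n)) i j : `|x i j| <= `|x|.
Proof. by rewrite [leRHS]mx_normrE (le_bigmax _ _ (i, j)). Qed.

Lemma norm_coord n (x : 'rV[R]_n) : (0 < n)%N -> exists j, `|x| = `|x 0 j|.
Proof.
move=> n0; have [x0|/eqP/mx_norm_neq0[[i j] xj]] := pselect (`|x| = 0).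
  exists (Ordinal n0); apply/eqP; rewrite eq_le le_coord_norm andbT.
  by rewrite x0.
by exists j; rewrite [LHS]xj (ord1 i).
Qed.

Variables (k : nat) (M : R) (h : 'rV[R]_k -> R).
Hypotheses (k0 : (0 < k)%N) (h_lipschitz : M.-lipschitz h)
  (h_vanish : forall t : 'rV[R]_k, (exists j, t ord0 j = 0) -> h t = 0).

Lemma lipschitz_coord (x y : 'rV[R]_k) :
  exists j, `|h x - h y| <= `|M * x 0 j - M * y 0 j|.
Proof.
have [j xyj] := norm_coord (x - y) k0; exists j.
have := h_lipschitz (x := (x, y)) (conj I I); rewrite /self_sub/= xyj !mxE.
by move/le_trans; apply; rewrite -mulrBr normrM ler_wpM2r// ler_norm.
Qed.

(* Compare with the vector obtained by cancelling the [j]-th coordinate. *)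
Lemma lipschitz_vanish (x : 'rV[R]_k) j : `|h x| <= `|M * x 0 j|.
Proof.
pose y := \row_l (if l == j then 0 else x 0 l).
have hy : h y = 0 by apply: h_vanish; exists j; rewrite mxE eqxx.
have [l] := lipschitz_coord x y; rewrite hy subr0 mxE.
(* [x] and [y] differ only at [j]: if [l] is [j] this is the claim, otherwise the bound on [h x] is
   0. *)
by case: eqP => [->|_]; rewrite ?mulr0 ?subr0// subrr normr0 => /le_trans; apply.
Qed.

End rows.

(* A matrix t : 'M[R]_(N, k) is an element of V^N with t_i = row i t; the norm
   of 'rV[R]_k is the max norm. *)
Theorem theorem2p1 (R : realType) (N k : nat) (N_ge1 : (1 <= N)%N)
  (k_ge1 : (1 <= k)%N)
  (T : set 'M[R]_(N, k)) (T_bounded : bounded_set T)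
  (M : 'I_N -> R) (h : 'I_N -> 'rV[R]_k -> R)
  (h_lipschitz : forall i, (M i).-lipschitz (h i))
  (h_vanish : forall i (t : 'rV[R]_k), (exists j, t ord0 j = 0) -> h i t = 0)
  (d : measure_display) (Omega : measurableType d) (P : probability Omega R)
  (eps : 'I_N -> {RV P >-> R}) (eps2 : 'I_N -> 'I_k -> {RV P >-> R})
  (eps_rademacher : forall i, rademacher (eps i))
  (eps2_rademacher : forall i j, rademacher (eps2 i j))
  (eps_indep : mutually_independent (join_family eps eps2)) :
  (forall Phi : R -> R,
     @convex_function R R^o `[0, +oo[ Phi ->
     {in `[0, +oo[ &, nondecreasing_fun Phi} ->
     ('E_P[fun w => (Phi (2^-1 *
          sup [set `|\sum_(i < N) eps i w * h i (row i t)| | t in T]))%R]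
      <= 'E_P[fun w => (Phi (Num.max
          (sup [set \sum_(i < N) \sum_(j < k) M i * eps2 i j w * t i j
               | t in T]) 0))%R]
      <= 'E_P[fun w => (Phi
          (sup [set `|\sum_(i < N) \sum_(j < k) M i * eps2 i j w * t i j|
               | t in T]))%R])%E)
  /\
  (forall G : R -> R,
     @convex_function R R^o setT G ->
     nondecreasing_fun G ->
     ('E_P[fun w => (G (sup [set \sum_(i < N) eps i w * h i (row i t)
                            | t in T]))%R]
      <= 'E_P[fun w => (G
          (sup [set \sum_(i < N) \sum_(j < k) M i * eps2 i j w * t i j
               | t in T]))%R])%E).
Proof.
have rad s : rademacher (join_family eps eps2 s).
  by case: s => [i|[i j]]; [exact: eps_rademacher|exact: eps2_rademacher].
(* Every expectation becomes the same positive multiple of a sum over sign vectors, so only finite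
   sums remain to be compared. *)
have EE F : ('E_P[fun w => F ((join_family eps eps2) ^~ w)] = _)%E :=
  rademacher_expectation rad eps_indep F.
pose X (x : 'I_N + 'I_N * 'I_k -> R) t := \sum_(i < N) x (inl i) * h i (row i t).
pose Y (x : 'I_N + 'I_N * 'I_k -> R) (t : 'M[R]_(N, k)) :=
  \sum_(i < N) \sum_(j < k) M i * x (inr (i, j)) * t i j.
have tB i j : bounded_on T (fun t : 'M[R]_(N, k) => M i * t i j).
  apply: bounded_onM; have [B [_ TB]] := T_bounded; exists (B + 1) => t Tt.
  by apply: le_trans (le_coord_norm t i j) _; apply: TB => //; lra.
have ht i t j : `|h i (row i t)| <= `|M i * t i j|.
  by have := lipschitz_vanish k_ge1 (h_lipschitz i) (h_vanish i) (row i t) j; rewrite mxE.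
have hB i : bounded_on T (fun t => h i (row i t)).
  have [B tiB] := tB i (Ordinal k_ge1); exists B => t /tiB.
  exact: le_trans (ht _ _ _).
have hlip i (t t' : 'M[R]_(N, k)) : T t -> T t' ->
    exists j, `|h i (row i t) - h i (row i t')| <= `|M i * t i j - M i * t' i j|.
  move=> _ _; have [j] := lipschitz_coord k_ge1 (h_lipschitz i) (row i t) (row i t').
  by rewrite !mxE; exists j.
have XB x : bounded_on T (X x).
  by apply: bounded_on_sum => i; exact: bounded_onM.
have YB x : bounded_on T (Y x).
  apply: bounded_on_sum => i; apply: bounded_on_sum => j.
  have [B tijB] := bounded_onM (x (inr (i, j))) (tB i j); exists B => t /tijB.
  by rewrite mulrA (mulrC (M i)).
pose sg (s : {ffun 'I_N + 'I_N * 'I_k -> bool}) i : R := (-1) ^+ s i.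
have contr G : @convex_function R R^o setT G -> nondecreasing_fun G ->
    \sum_s G (sup [set X (sg s) t | t in T]) <=
    \sum_s G (sup [set Y (sg s) t | t in T]).
  move=> cG nG; have [->|/set0P T0] := eqVneq T set0.
    by apply: ler_sum => s _; rewrite !image_set0.
  have := rademacher_contraction cG nG T0 hB tB (fun i u j _ => ht i u j) hlip.
  congr (_ <= _); apply: eq_bigr => s _; congr G; apply: eq_sup_image => t _.
  by apply: eq_bigr => i _; apply: eq_bigr => j _; rewrite mulrA (mulrC (M i)).
have weight_gt0 : 0 < (2^-1 : R) ^+ #|{: 'I_N + 'I_N * 'I_k}|.
  by rewrite exprn_gt0// invr_gt0.
split => [Phi cPhi nPhi|G cG nG]; last first.
  rewrite (EE (fun x => G (sup [set X x t | t in T]))).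
  rewrite (EE (fun x => G (sup [set Y x t | t in T]))).
  by rewrite lee_fin ler_pM2l//; exact: contr.
rewrite (EE (fun x => Phi (2^-1 * sup [set `|X x t| | t in T]))).
rewrite (EE (fun x => Phi (Num.max (sup [set Y x t | t in T]) 0))).
rewrite (EE (fun x => Phi (sup [set `|Y x t| | t in T]))).
rewrite !lee_fin !ler_pM2l//.
(* For empty [T] the suprema take the default value 0, and all three arguments of [Phi] are 0. *)
have [T0|/set0P T0] := eqVneq T set0.
  apply/andP; split; apply: ler_sum => s _;
    by rewrite T0 !image_set0 sup0 ?mulr0 maxxx.
(* The second inequality holds for each sign vector separately. *)
apply/andP; split; last first.
  apply: ler_sum => s _; apply: nondecreasing_pos => //.
    by rewrite le_max lexx orbT.
  have aB := bounded_on_norm (YB (sg s)).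
  rewrite ge_max; apply/andP; split.
    apply: sup_image_le => // t Tt.
    exact: le_trans (ler_norm _) (le_sup_image T0 aB Tt).
  by have [t Tt] := T0; apply: le_trans (le_sup_image T0 aB Tt).
(* Contraction for [Phi (Num.max x 0)] reduces the first inequality to one that involves only
   [X]. *)
apply: le_trans (contr _ (convex_function_pos_part cPhi nPhi)
  (nondecreasing_pos_part nPhi)).
rewrite -(ler_pM2l (ltr0n R 2)) [leRHS]mulr_natl mulr2n.
(* Reversing all signs turns [X] into [- X], so [a] and [b] are the positive parts of the suprema of
   [X] and [- X]. Then [|X| <= a + b], and convexity at the midpoint of [a] and [b] accounts for the
   factor 1/2. *)
rewrite [X in _ <= _ + X](sum_flip predT) -big_split/= mulr_sumr.
apply: ler_sum => s _.
set a := Num.max _ 0; set b := Num.max _ 0.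
have a0 : 0 <= a by rewrite le_max lexx orbT.
have b0 : 0 <= b by rewrite le_max lexx orbT.
have XN t : X (sg (flip predT s)) t = - X (sg s) t.
  rewrite -sumrN; apply: eq_bigr => i _.
  by rewrite /sg ffunE/= addbT signrN mulNr.
have ab : sup [set `|X (sg s) t| | t in T] <= a + b.
  apply: sup_image_le => // t Tt.
  have Xa : X (sg s) t <= a.
    by rewrite le_max (le_sup_image T0 (XB _) Tt).
  have Xb : - X (sg s) t <= b.
    by rewrite -XN le_max (le_sup_image T0 (XB _) Tt).
  rewrite ler_norml; apply/andP; split; lra.
have nonneg x : 0 <= x -> (`[0, +oo[%classic : set R) x by rewrite /= in_itv/= andbT.
have h0 : 0 <= 2^-1 :> R by [].
have h1 : 2^-1 <= 1 :> R by lra.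
have := convex_functionP cPhi (nonneg a a0) (nonneg b b0) h0 h1.
have : Phi (2^-1 * sup [set `|X (sg s) t| | t in T]) <=
    Phi (2^-1 * a + (1 - 2^-1) * b).
  apply: nondecreasing_pos => //; last lra.
  rewrite mulr_ge0//; have [t Tt] := T0.
  exact: le_trans (le_sup_image T0 (bounded_on_norm (XB (sg s))) Tt).
lra.
Qed.
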